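(* Let $q>2$ and let $(M,d,\nabla,\lambda)$ be a space satisfying the standing assumptions listed in the context. Let $U:M\to[0,\infty)$ be a differentiable function with $\int e^{-U}d\lambda<\infty$, and let $$d\mu=\frac{e^{-U}\,d\lambda}{\int e^{-U}d\lambda}.$$ Suppose that there are constants $\hat C,\hat D>0$ such that for every $f\in C^\infty$, $$\int |f|^2\left(|\nabla U|^2+U\right)d\mu\;\le\;\hat C\int H_q\!\left(\frac{|\nabla f|}{f}\right)f^2\,d\mu+\hat D\int|f|^2\,d\mu .$$ Then there exist constants $C,D>0$ such that for every $f\in C^\infty$, $$\int|f|^2\log\frac{|f|^2}{\int|f|^2d\mu}\,d\mu\;\le\; C\int H_q\!\left(\frac{|\nabla f|}{f}\right)f^2\,d\mu+D\int f^2\,d\mu .$$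
   Context: For $q>2$, the function $H_q:\mathbb{R}\to\mathbb{R}$ is defined by $H_q(x)=x^2$ if $|x|\le 1$ and $H_q(x)=|x|^q$ if $|x|\ge 1$. The integrand $H_q(|\nabla f|/f)f^2$ is taken to be $0$ on $\{f=0\}$. As usual, functions $f$ are real-valued, not a.e. zero, with $\int f^2d\mu<\infty$, and the inequalities are read in $[0,\infty]$. Standing assumptions on the space. $M$ is an $n$-dimensional non-compact metric space (for instance $\mathbb{R}^n$ with the Euclidean distance, or the Heisenberg group with the Carnot-Carathéodory distance), $\lambda$ is the $n$-dimensional Lebesgue measure on $M$, $x_0\in M$ is a fixed point and $d(x)=d(x_0,x)$ denotes the distance from $x_0$. $\nabla$ is the gradient or sub-gradient (on $\mathbb{R}^n$ the usual gradient, on the Heisenberg group the horizontal gradient), $|\nabla f|$ is its Euclidean length, and $\Delta$ is the associated (sub-)Laplacian, so that $\int \nabla f\cdot\nabla g\,d\lambda=-\int f\,\Delta g\,d\lambda$ in the weak sense. It is assumed that: (1) $\frac1\sigma<|\nabla d|\le 1$ for some $\sigma\in[1,\infty)$, and $\Delta d\le K$ outside the unit ball $\{d(x)<1\}$ for some $K\in(0,\infty)$; (2) (Classical Sobolev inequality) there are $\epsilon,\alpha,\beta>0$ such that $\left(\int |f|^{2+\epsilon}d\lambda\right)^{\frac{2}{2+\epsilon}}\le \alpha\int|\nabla f|^2d\lambda+\beta\int|f|^2d\lambda$ for all $f$; (3) (local Poincaré inequality) for each $R>0$ there is $c_R\in(0,\infty)$ such that for every ball $B_R$ of radius $R$ and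 all $f$, $\frac{1}{|B_R|}\int_{B_R}\left|f-\frac{1}{|B_R|}\int_{B_R}f\,d\lambda\right|^2d\lambda\le c_R\frac{1}{|B_R|}\int_{B_R}|\nabla f|^2d\lambda$, where $|B_R|=\lambda(B_R)$. *)

(* Defs.v *)
From HB Require Import structures.
From mathcomp Require Import all_boot all_order all_algebra.
From mathcomp Require Import all_classical all_reals all_analysis.

Set Implicit Arguments.
Unset Strict Implicit.
Unset Printing Implicit Defensive.

Import Order.TTheory GRing.Theory Num.Theory.
Import numFieldNormedType.Exports.

Local Open Scope classical_set_scope.
Local Open Scope ring_scope.

#[short(type="metricMeasurableType")]
HB.structure Definition MetricMeasurable (R : numDomainType)
    (d : measure_display) := { M of Metric R M & Measurable d M }.

Definition borel_measurable (R : realType) (d : measure_display)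
    (M : metricMeasurableType R d) : Prop :=
  @measurable d M = <<s [set A : set M | open A] >>.

Section EuclideanCalculus.
Context {R : realType} {n : nat}.

Definition partial (j : 'I_n) (g : 'rV[R]_n -> R) : 'rV[R]_n -> R :=
  fun y => 'D_(delta_mx 0 j : 'rV[R]_n) g y.

(* Meaningful for open [O]: the values of [g] outside [O] play no role. *)
Fixpoint Ck_on (k : nat) (O : set 'rV[R]_n) (g : 'rV[R]_n -> R) : Prop :=
  match k with
  | 0%N => forall y, O y -> {for y, continuous g}
  | k'.+1 => (forall y, O y -> differentiable g y) /\
             (forall j : 'I_n, Ck_on k' O (partial j g))
  end.

Definition smooth_on (O : set 'rV[R]_n) (g : 'rV[R]_n -> R) : Prop :=
  forall k, Ck_on k O g.

Definition closed_box (a b : 'rV[R]_n) : set 'rV[R]_n :=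
  [set y | forall j, a 0 j <= y 0 j <= b 0 j].

End EuclideanCalculus.

Record chart (R : realType) (n : nat) (M : topologicalType) := Chart {
  chart_dom : set M ;
  chart_map :> M -> 'rV[R]_n ;
  chart_inv : 'rV[R]_n -> M ;
  chart_dom_open : open chart_dom ;
  chart_img_open : open (chart_map @` chart_dom) ;
  chart_mapK : forall x, chart_dom x -> chart_inv (chart_map x) = x ;
  chart_map_continuous : forall x, chart_dom x -> {for x, continuous chart_map} ;
  chart_inv_continuous : forall y, (chart_map @` chart_dom) y ->
    {for y, continuous chart_inv}
}.

Section Atlas.
Context {R : realType} {n : nat} {M : topologicalType}.

Definition chart_img (c : chart R n M) : set 'rV[R]_n := c @` chart_dom c.

(* A countable smooth atlas; domains may be empty, so finite atlases (e.g. the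
   single global chart of R^n or of the Heisenberg group) are included. *)
Definition smooth_atlas (c : nat -> chart R n M) : Prop :=
  (forall x, exists i, chart_dom (c i) x) /\
  (forall i j (k : 'I_n),
     smooth_on (c i @` (chart_dom (c i) `&` chart_dom (c j)))
       (fun y => c j (chart_inv (c i) y) 0 k)).

Definition smooth_fun (c : nat -> chart R n M) (f : M -> R) : Prop :=
  forall i, smooth_on (chart_img (c i)) (f \o chart_inv (c i)).

Definition differentiable_at (c : nat -> chart R n M) (f : M -> R) (x : M) :
    Prop :=
  forall i, chart_dom (c i) x -> differentiable (f \o chart_inv (c i)) (c i x).

Definition differentiable_fun (c : nat -> chart R n M) (f : M -> R) : Prop :=
  forall x, differentiable_at c f x.

(* [nabla f = (X_1 f, ..., X_m f)] for smooth vector fields X_1, ..., X_m,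
   where X_k = \sum_j a_kj d/dy_j in each chart. The value of [nabla f x] is
   left unspecified where [f] is not differentiable. The usual gradient of R^n
   is the case m = n and X_j = d/dy_j; the horizontal gradient of the Heisenberg
   group is the case n = 3, m = 2 and X_1, X_2 the left-invariant horizontal
   fields. *)
Definition sub_gradient (m : nat) (c : nat -> chart R n M)
    (nabla : (M -> R) -> M -> 'rV[R]_m) : Prop :=
  forall i, exists a : 'I_m -> 'I_n -> 'rV[R]_n -> R,
    (forall k j, smooth_on (chart_img (c i)) (a k j)) /\
    (forall (f : M -> R) (x : M), chart_dom (c i) x -> differentiable_at c f x ->
       forall k, nabla f x 0 k =
         \sum_(j < n) a k j (c i x) * partial j (f \o chart_inv (c i)) (c i x)).

End Atlas.

Section Analysis.
Context {R : realType} {n m : nat} {d : measure_display}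
  {M : metricMeasurableType R d}.

Definition dotv (u v : 'rV[R]_m) : R := \sum_(k < m) u 0 k * v 0 k.

Definition gradnorm (nabla : (M -> R) -> M -> 'rV[R]_m) (f : M -> R) (x : M) : R :=
  Num.sqrt (dotv (nabla f x) (nabla f x)).

(* [lambda] is the n-dimensional Lebesgue measure read in the charts. Boxes
   contained in the image of a chart generate its Borel sets, so this determines
   [lambda] on the domain of each chart. *)
Definition lebesgue_in_charts (c : nat -> chart R n M)
    (lambda : {measure set M -> \bar R}) : Prop :=
  forall i (a b : 'rV[R]_n), (forall j, a 0 j <= b 0 j) ->
    closed_box a b `<=` chart_img (c i) ->
    lambda (chart_dom (c i) `&` c i @^-1` closed_box a b) =
      (\prod_(j < n) (b 0 j - a 0 j))%:E.

Definition dist_from (x0 : M) : M -> R := fun x => mdist x0 x.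

Definition gradient_dist_bound (c : nat -> chart R n M)
    (lambda : {measure set M -> \bar R})
    (nabla : (M -> R) -> M -> 'rV[R]_m) (x0 : M) (sigma : R) : Prop :=
  {ae lambda, forall x, differentiable_at c (dist_from x0) x /\
     sigma^-1 < gradnorm nabla (dist_from x0) x <= 1}.

(* [Delta g <= K] on [A] in the weak sense, that is after testing against
   nonnegative smooth compactly supported [phi] vanishing outside [A], with
   \int phi Delta g = - \int nabla phi . nabla g. *)
Definition weak_laplacian_le (c : nat -> chart R n M)
    (lambda : {measure set M -> \bar R})
    (nabla : (M -> R) -> M -> 'rV[R]_m) (g : M -> R) (K : R) (A : set M) : Prop :=
  forall phi : M -> R, smooth_fun c phi -> (forall x, 0 <= phi x) ->
    (exists2 S : set M, compact S & forall x, ~ S x -> phi x = 0) ->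
    (forall x, ~ A x -> phi x = 0) ->
    (- (\int[lambda]_x (dotv (nabla phi x) (nabla g x))%:E)
     <= K%:E * (\int[lambda]_x (phi x)%:E))%E.

Definition distance_assumption (c : nat -> chart R n M)
    (lambda : {measure set M -> \bar R})
    (nabla : (M -> R) -> M -> 'rV[R]_m) (x0 : M) : Prop :=
  (exists2 sigma : R, 1 <= sigma & gradient_dist_bound c lambda nabla x0 sigma) /\
  (exists2 K : R, 0 < K &
     weak_laplacian_le c lambda nabla (dist_from x0) K
       [set x | 1 <= dist_from x0 x]).

Definition classical_sobolev (c : nat -> chart R n M)
    (lambda : {measure set M -> \bar R})
    (nabla : (M -> R) -> M -> 'rV[R]_m) : Prop :=
  exists eps alpha beta : R, [/\ 0 < eps, 0 < alpha, 0 < beta &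
    forall f : M -> R, differentiable_fun c f ->
      ((\int[lambda]_x (`|f x| `^ (2 + eps))%:E) `^ (2 / (2 + eps))
       <= alpha%:E * (\int[lambda]_x (gradnorm nabla f x ^+ 2)%:E)
          + beta%:E * (\int[lambda]_x (`|f x| ^+ 2)%:E))%E].

Definition mean_on (lambda : {measure set M -> \bar R}) (B : set M)
    (f : M -> R) : R :=
  fine ((lambda B)^-1 * \int[lambda]_(x in B) (f x)%:E)%E.

(* The integrability of [f] on the ball is what gives its mean a meaning. *)
Definition local_poincare (c : nat -> chart R n M)
    (lambda : {measure set M -> \bar R})
    (nabla : (M -> R) -> M -> 'rV[R]_m) : Prop :=
  forall r : R, 0 < r -> exists2 cr : R, 0 < cr &
    forall (y : M) (f : M -> R), differentiable_fun c f ->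
      lambda.-integrable (ball y r) (EFin \o f) ->
      ((lambda (ball y r))^-1 * \int[lambda]_(x in ball y r)
           (`|f x - mean_on lambda (ball y r) f| ^+ 2)%:E
       <= cr%:E * ((lambda (ball y r))^-1 *
            \int[lambda]_(x in ball y r) (gradnorm nabla f x ^+ 2)%:E))%E.

Definition partition_fun (lambda : {measure set M -> \bar R}) (U : M -> R) :
    \bar R := (\int[lambda]_x (expR (- U x))%:E)%E.

Definition gibbs_measure (lambda : {measure set M -> \bar R}) (U : M -> R)
    (mu : {measure set M -> \bar R}) : Prop :=
  forall A, measurable A ->
    mu A = ((\int[lambda]_(x in A) (expR (- U x))%:E)
            * (partition_fun lambda U)^-1)%E.

Definition Hq (q x : R) : R := if `|x| <= 1 then x ^+ 2 else `|x| `^ q.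

Definition modified_energy (nabla : (M -> R) -> M -> 'rV[R]_m)
    (mu : {measure set M -> \bar R}) (q : R) (f : M -> R) : \bar R :=
  (\int[mu]_x (if f x == 0 then 0
               else Hq q (gradnorm nabla f x / f x) * f x ^+ 2)%:E)%E.

Definition sq_mass (mu : {measure set M -> \bar R}) (f : M -> R) : \bar R :=
  (\int[mu]_x (`|f x| ^+ 2)%:E)%E.

Definition test_fun (c : nat -> chart R n M) (mu : {measure set M -> \bar R})
    (f : M -> R) : Prop :=
  [/\ smooth_fun c f, ~ {ae mu, forall x, f x = 0} & (sq_mass mu f < +oo)%E].

End Analysis.

(* Main.v *)
Require Import Defs.
From HB Require Import structures.
From mathcomp Require Import all_boot all_order all_algebra.
From mathcomp Require Import all_classical all_reals all_analysis.
From mathcomp Require Import measurable_realfun ring lra.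

Set Implicit Arguments.
Unset Strict Implicit.
Unset Printing Implicit Defensive.

Import Order.TTheory GRing.Theory Num.Theory.
Import numFieldNormedType.Exports.

Local Open Scope classical_set_scope.
Local Open Scope ring_scope.

(** The measure [mu] has density [exp (- U) / Z] with respect to [lambda], so
    the classical Sobolev inequality applied to [f exp (- U / 2)] is an
    inequality about [f] and [mu]. The square of its gradient is at most
    [(2 |nabla f|^2 + f^2 |nabla U|^2 / 2) exp (- U)]. As [q > 2], one has
    [x^2 <= H_q x], which controls the first term by the modified energy, and
    the hypothesis on [U] controls the second one. The resulting bound on the
    [(2 + eps)]-norm of [f exp (- U / 2)] yields the entropy of [f]: pointwise,
    [ln (f^2) = 2 ln |f exp (- U / 2)| + U], where the term [f^2 U] is again
    controlled by the hypothesis on [U], and [ln w <= w], for a suitable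
    multiple [w] of [|f exp (- U / 2)|^eps], turns the logarithm into the
    moment of order [2 + eps]. This last step is the elementary form of the
    usual appeal to Jensen's inequality.

    One point needs care. The modified energy ignores [{f = 0}], whereas
    [|nabla f|^2] is integrated over the whole space. Instead of proving that
    [nabla f = 0] almost everywhere on [{f = 0}], the proof applies the Sobolev
    inequality to [soft_cut s f * exp (- U / 2)], where [s] is the mass of
    [f^2] and [soft_cut s t = t^3 / (t^2 + s)]. This function has a bounded
    derivative that vanishes at [0], it satisfies [|soft_cut s t| <= |t|], and
    it is comparable with [t] where [t^2 >= s]. The entropy density
    [f^2 ln (f^2 / s)] is nonpositive on the set where [f^2 < s], so the cut
    loses nothing there ([entropy_pointwise]).

    The lemmas that carry the argument are [ground_state_gradnorm] (the bound
    on the gradient), [ground_state_sobolev] (the bound on the moment),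
    [entropy_pointwise] and [entropy_bound]. The sums of integrals are split
    with the help of measurability. For the gradient of the merely
    differentiable [U] it comes from difference quotients in the charts
    ([measurable_partial]). *)

(** * Integration against a density *)

Section Density.
Context d (T : measurableType d) (R : realType).

Import HBNNSimple.

(** Both sides are monotone limits along simple functions, for which the
    identity is the definition of the density. *)
Lemma integral_density (mu nu : {measure set T -> \bar R}) (g : T -> R)
    (f : T -> \bar R) :
    (forall x, 0 <= g x) -> measurable_fun setT g ->
    (forall A, measurable A -> nu A = (\int[mu]_(x in A) (g x)%:E)%E) ->
    (forall x, (0 <= f x)%E) -> measurable_fun setT f ->
  (\int[mu]_x (f x * (g x)%:E) = \int[nu]_x f x)%E.
Proof.
move=> g0 mg nuE f0 mf.
have mgE : measurable_fun setT (EFin \o g) by exact/measurable_EFinP.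
pose h := nnsfun_approx measurableT mf.
have hf x : (h n x)%:E @[n --> \oo] --> f x by exact: cvg_nnsfun_approx.
have mh n : measurable_fun setT (EFin \o h n) by exact/measurable_EFinP.
have hnd x : {homo (fun n => (h n x)%:E) : a b / (a <= b)%N >-> (a <= b)%E}.
  by move=> a b ab; rewrite lee_fin; exact/lefP/nd_nnsfun_approx.
have cvnu : (\int[nu]_x (h n x)%:E)%E @[n --> \oo] --> (\int[nu]_x f x)%E.
  have -> : f = (fun x => limn (fun n => (h n x)%:E)).
    by apply/funext => x; apply/esym/cvg_lim => //; exact: hf.
  by apply: cvg_monotone_convergence => // n x _; rewrite lee_fin.
have cvmu : (\int[mu]_x ((h n x)%:E * (g x)%:E))%E @[n --> \oo] -->
    (\int[mu]_x (f x * (g x)%:E))%E.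
  have -> : (fun x => f x * (g x)%:E)%E =
      (fun x => limn (fun n => (h n x)%:E * (g x)%:E)%E).
    apply/funext => x; apply/esym/cvg_lim => //.
    by apply: cvgeZr => //; exact: hf.
  apply: cvg_monotone_convergence => //.
  - by move=> n; exact: (emeasurable_funM (mh n) mgE).
  - by move=> n x _; rewrite mule_ge0 ?lee_fin.
  - move=> x _ a b ab; rewrite lee_wpmul2r ?lee_fin ?g0//.
    exact/lefP/nd_nnsfun_approx.
rewrite -(cvg_lim _ cvmu)// -(cvg_lim _ cvnu)//; apply: congr_lim.
apply/funext => n.
have indic0 r x : (0 <= (r * \1_(h n @^-1` [set r]) x)%:E)%E.
  exact: nnfun_muleindic_ge0.
have mindic r : measurable_fun setT
    (fun x => (r * \1_(h n @^-1` [set r]) x)%:E).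
  by apply/measurable_EFinP; exact: measurable_funM.
have hE x : (h n x)%:E =
    (\sum_(r \in range (h n)) (r * \1_(h n @^-1` [set r]) x)%:E)%E.
  by rewrite fsumEFin// [in LHS](fimfunE (h n)).
under eq_integral do rewrite hE ge0_mule_fsuml//.
under [RHS]eq_integral do rewrite hE.
rewrite !ge0_integral_fsum//; last 2 first.
- by move=> r; exact: (emeasurable_funM (mindic r) mgE).
- by move=> r x _; apply: mule_ge0; [exact: indic0|rewrite lee_fin].
apply: eq_fsbigr => r; rewrite inE => -[t _ rE].
have r0 : 0 <= r by rewrite -rE.
have mr : measurable (h n @^-1` [set r]) by exact: measurable_funPTI.
under eq_integral do rewrite EFinM -muleA.
rewrite ge0_integralZl//; last 2 first.
- by apply: emeasurable_funM => //; exact/measurable_EFinP.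
- by move=> x _; rewrite mule_ge0 ?lee_fin.
under [RHS]eq_integral do rewrite EFinM.
rewrite [RHS]ge0_integralZl//; last exact/measurable_EFinP.
rewrite integral_indic// setIT nuE//; congr (_ * _)%E.
rewrite [RHS]integral_mkcond.
by under [RHS]eq_integral do rewrite epatch_indic muleC.
Qed.

End Density.
(** * Borel measurability in charts *)

Section Borel.
Context (R : realType) (d : measure_display) (M : metricMeasurableType R d).
Hypothesis M_borel : borel_measurable M.

Lemma open_borel (A : set M) : open A -> measurable A.
Proof. by move=> oA; rewrite M_borel; exact: sub_sigma_algebra. Qed.

Lemma continuous_borel (A : set M) (f : M -> R) : open A ->
  (forall x, A x -> {for x, continuous f}) -> measurable_fun A f.
Proof.
move=> oA cf; apply: (measurability _ (RGenOpens.measurableE R)).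
move=> _ [_ [a [b ->] <-]]; apply: open_borel.
rewrite openE => x [Ax fx]; apply: filterI; first exact: open_nbhs_nbhs.
apply: cf => //; apply: open_nbhs_nbhs; split => //; exact: interval_open.
Qed.

End Borel.

Section ChartMeasurability.
Context (R : realType) (n : nat) (d : measure_display)
  (M : metricMeasurableType R d).
Hypothesis M_borel : borel_measurable M.
Variable c : chart R n M.

Lemma chart_img_in (x : M) : chart_dom c x -> chart_img c (c x).
Proof. by exists x. Qed.

Lemma measurable_chart_dom : measurable (chart_dom c).
Proof. by apply: open_borel => //; exact: chart_dom_open. Qed.

Lemma chart_shift_continuous (v : 'rV[R]_n) (x : M) : chart_dom c x ->
  {for x, continuous (fun z : M => v + c z)}.
Proof.
move=> cx; apply: cvgD; first exact: cvg_cst.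
exact: chart_map_continuous.
Qed.

Lemma continuous_chart_comp (g : 'rV[R]_n -> R) (v : 'rV[R]_n) (x : M) :
  chart_dom c x -> {for v + c x, continuous g} ->
  {for x, continuous (fun z : M => g (v + c z))}.
Proof.
move=> cx cg; apply: (@continuous_comp _ _ _ (fun z => v + c z) g x) => //.
exact: chart_shift_continuous.
Qed.

Lemma measurable_chart_comp (g : 'rV[R]_n -> R) :
  (forall y, chart_img c y -> {for y, continuous g}) ->
  measurable_fun (chart_dom c) (g \o c).
Proof.
move=> cg; apply: continuous_borel => //; first exact: chart_dom_open.
move=> x cx; apply: continuous_comp; first exact: chart_map_continuous.
by apply: cg; exact: chart_img_in.
Qed.

(** A partial derivative is the limit of the difference quotients with step
    [1 / (k + 1)]. The shifted point may leave the image of the chart, where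
    nothing is known about [g]; the quotient is therefore replaced by [0] off
    the open set [O k] of points whose shift stays inside, and each point
    eventually enters [O k]. *)
Lemma measurable_partial (j : 'I_n) (g : 'rV[R]_n -> R) :
  (forall y, chart_img c y -> differentiable g y) ->
  measurable_fun (chart_dom c) (partial j g \o c).
Proof.
move=> dg; pose e : 'rV[R]_n := delta_mx 0 j.
pose s k : R := harmonic k.
have s0 k : s k != 0 by rewrite /s /harmonic invr_eq0 pnatr_eq0.
pose O k := chart_dom c `&` [set x | chart_img c (s k *: e + c x)].
have oO k : open (O k).
  rewrite openE => x [cx ix]; apply: filterI.
    by apply: open_nbhs_nbhs; split => //; exact: chart_dom_open.
  apply: chart_shift_continuous => //; apply: open_nbhs_nbhs; split => //.
  exact: chart_img_open.
have mO k : measurable (O k) by exact: open_borel.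
pose q k x := (s k)^-1 * (g (s k *: e + c x) - g (c x)).
apply: (@measurable_fun_cvg _ _ _ _ (fun k x => if x \in O k then q k x else 0)).
- move=> k.
  have -> : chart_dom c = O k `|` (chart_dom c `\` O k).
    by rewrite setDUK// => x [].
  apply/measurable_funU => //.
    by apply: measurableD => //; exact: measurable_chart_dom.
  split.
    apply: (@eq_measurable_fun _ _ _ _ _ (q k)).
      by move=> x ->.
    apply: continuous_borel => // x [cx ix].
    apply: cvgM; first exact: cvg_cst.
    apply: cvgB.
      apply: (@continuous_chart_comp g) => //.
      by apply: differentiable_continuous; exact: dg.
    apply: continuous_comp; first exact: chart_map_continuous.
    by apply: differentiable_continuous; apply: dg; exact: chart_img_in.
  apply: (@eq_measurable_fun _ _ M R _ (fun=> 0)); last exact: measurable_cst.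
  by move=> x; rewrite inE => -[_ nO]; case: ifPn => // /set_mem.
- move=> x cx.
  have dgx : derivable g (c x) e by apply/diff_derivable/dg/chart_img_in.
  have cvs : s k @[k --> \oo] --> 0^'.
    move=> A /= A0.
    have N0 : nbhs (0 : R) [set y | y != 0 -> A y] by exact: A0.
    have : \forall k \near \oo, s k != 0 -> A (s k) by exact: cvg_harmonic N0.
    by apply: filterS => k /(_ (s0 k)).
  have := cvg_comp _ _ cvs dgx; apply: cvg_trans.
  apply: near_eq_cvg; near=> k.
  have Ok : O k x.
    split => //=; near: k.
    have : (s k *: e + c x) @[k --> \oo] --> 0 *: e + c x.
      by apply: cvgD; [apply: cvgZr_tmp; exact: cvg_harmonic|exact: cvg_cst].
    apply; rewrite scale0r add0r; apply: open_nbhs_nbhs; split.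
      exact: chart_img_open.
    exact: chart_img_in.
  by rewrite mem_set.
Unshelve. all: by end_near. Qed.

End ChartMeasurability.

(** * The gradient of composed functions *)

Section Gradient.
Context (R : realType) (n m : nat) (d : measure_display)
  (M : metricMeasurableType R d) (c : nat -> chart R n M)
  (nabla : (M -> R) -> M -> 'rV[R]_m).

Lemma smooth_differentiable (f : M -> R) :
  smooth_fun c f -> differentiable_fun c f.
Proof. by move=> sf x i cx; have [+ _] := sf i 1%N; apply; exists x. Qed.

Lemma differentiable_on_chart (f : M -> R) i y : differentiable_fun c f ->
  chart_img (c i) y -> differentiable (f \o chart_inv (c i)) y.
Proof. by move=> df [x cx <-]; exact: df. Qed.

Lemma gradnorm_sqr (f : M -> R) x :
  gradnorm nabla f x ^+ 2 = \sum_(k < m) nabla f x 0 k ^+ 2.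
Proof.
rewrite /gradnorm sqr_sqrtr.
  by apply: eq_bigr => k _; rewrite -expr2.
by apply: sumr_ge0 => k _; rewrite -expr2 sqr_ge0.
Qed.

(** This is the inequality [(y + z)^2 <= 2 y^2 + 2 z^2] in each component. *)
Lemma gradnorm_sqr_comb (f g h : M -> R) (a b : R) x :
  (forall k, nabla h x 0 k = a * nabla f x 0 k + b * nabla g x 0 k) ->
  gradnorm nabla h x ^+ 2 <=
  2 * a ^+ 2 * gradnorm nabla f x ^+ 2 + 2 * b ^+ 2 * gradnorm nabla g x ^+ 2.
Proof.
move=> hE; rewrite !gradnorm_sqr !mulr_sumr -big_split /=.
apply: ler_sum => k _; rewrite hE.
set u := nabla f x 0 k; set v := nabla g x 0 k.
have := sqr_ge0 (a * u - b * v); nra.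
Qed.

Hypothesis c_atlas : smooth_atlas c.

Lemma differentiable_fun_continuous (f : M -> R) :
  differentiable_fun c f -> continuous f.
Proof.
move=> df x; have [i cx] := c_atlas.1 x.
have : {for x, continuous ((f \o chart_inv (c i)) \o c i)}.
  apply: continuous_comp; first exact: chart_map_continuous.
  by apply: differentiable_continuous; exact: df.
rewrite /prop_for /continuous_at /= chart_mapK//; apply: cvg_trans.
apply: near_eq_cvg.
have : nbhs x (chart_dom (c i)).
  by apply: open_nbhs_nbhs; split => //; exact: chart_dom_open.
by apply: filterS => y cy /=; rewrite chart_mapK.
Qed.

Hypothesis nabla_gradient : sub_gradient c nabla.

(** In a chart the gradient is a first-order operator, so that the chain and
    Leibniz rules for partial derivatives pass to [nabla]. *)
Lemma gradient_product (f g : M -> R) (t t' s s' : R -> R) :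
  differentiable_fun c f -> differentiable_fun c g ->
  (forall z : R, is_derive z 1 t (t' z)) ->
  (forall z : R, is_derive z 1 s (s' z)) ->
  let h x := t (f x) * s (g x) in
  differentiable_fun c h /\
  (forall x k, nabla h x 0 k = t' (f x) * s (g x) * nabla f x 0 k
                             + t (f x) * s' (g x) * nabla g x 0 k).
Proof.
move=> df dg dt ds h.
have diff1 (r r' : R -> R) : (forall z : R, is_derive z 1 r (r' z)) ->
    forall z, differentiable r z.
  by move=> dr z; apply/derivable1_diffP; have := dr z; move=> [].
have chain (r r' : R -> R) (u : 'rV[R]_n -> R) y j :
    (forall z : R, is_derive z 1 r (r' z)) -> differentiable u y ->
    partial j (r \o u) y = r' (u y) * partial j u y.
  move=> dr du; rewrite /partial !deriveE//; last first.
    by apply: differentiable_comp => //; exact: diff1 _ _ dr _.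
  rewrite diff_comp//; last exact: diff1 _ _ dr _.
  rewrite /= -[X in 'd r _ X]mulr1 -[X in 'd r _ X]/(_ *: _) linearZ/=.
  rewrite -(@deriveE R _ _ r (u y) (1 : R) (diff1 _ _ dr _)).
  by have [_ ->] := dr (u y); rewrite mulrC.
have dh : differentiable_fun c h.
  move=> x i cx.
  rewrite (_ : _ \o _ = (t \o (f \o chart_inv (c i))) *
                        (s \o (g \o chart_inv (c i)))) //.
  apply: differentiableM; apply: differentiable_comp.
  - exact: df.
  - exact: diff1 _ _ dt _.
  - exact: dg.
  - exact: diff1 _ _ ds _.
split => // x k.
have [i cx] := c_atlas.1 x; have [a [_ nablaE]] := nabla_gradient i.
rewrite (nablaE h x cx (dh x)) (nablaE f x cx (df x)) (nablaE g x cx (dg x)).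
rewrite !mulr_sumr -big_split/=.
apply: eq_bigr => j _.
rewrite [X in partial j X](_ : _ = (t \o (f \o chart_inv (c i))) *
                        (s \o (g \o chart_inv (c i)))) //.
have dfi : differentiable (f \o chart_inv (c i)) (c i x) by exact: df.
have dgi : differentiable (g \o chart_inv (c i)) (c i x) by exact: dg.
have -> : partial j ((t \o (f \o chart_inv (c i))) *
    (s \o (g \o chart_inv (c i)))) (c i x) =
  t (f x) * partial j (s \o (g \o chart_inv (c i))) (c i x) +
  s (g x) * partial j (t \o (f \o chart_inv (c i))) (c i x).
  rewrite /partial deriveM /= ?chart_mapK//.
    apply: diff_derivable; apply: differentiable_comp => //.
    exact: diff1 _ _ dt _.
  apply: diff_derivable; apply: differentiable_comp => //.
  exact: diff1 _ _ ds _.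
rewrite (chain _ _ _ _ _ dt)// (chain _ _ _ _ _ ds)//= chart_mapK//.
ring.
Qed.

Hypothesis M_borel : borel_measurable M.

Lemma measurable_differentiable_fun (f : M -> R) :
  differentiable_fun c f -> measurable_fun setT f.
Proof.
move=> df; apply: continuous_borel => //; first exact: openT.
by move=> x _; exact: differentiable_fun_continuous.
Qed.

(** The charts are countably many, and in each of them the gradient is a
    combination of partial derivatives with continuous coefficients. *)
Lemma measurable_gradnorm (f : M -> R) :
  differentiable_fun c f -> measurable_fun setT (gradnorm nabla f).
Proof.
move=> df.
have -> : setT = \bigcup_i chart_dom (c i).
  apply/seteqP; split => // x _; have [i cx] := c_atlas.1 x; by exists i.
apply/measurable_fun_bigcup => [i|i]; first exact: measurable_chart_dom.
have [a [sa nablaE]] := nabla_gradient i.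
rewrite /gradnorm /dotv.
apply: (measurable_comp measurableT) => //.
  apply: continuous_measurable_fun; exact: sqrt_continuous.
apply: measurable_sum => k.
suff mk : measurable_fun (chart_dom (c i)) (fun x => nabla f x 0 k).
  exact: measurable_funM.
apply: (@eq_measurable_fun _ _ _ _ _ (fun x => \sum_(j < n) a k j (c i x) *
    partial j (f \o chart_inv (c i)) (c i x))).
  by move=> x /set_mem cx; rewrite (nablaE _ x cx).
apply: measurable_sum => j; apply: measurable_funM.
  apply: (@measurable_chart_comp _ _ _ _ M_borel (c i) (a k j)) => y.
  exact: (sa k j 0%N y).
apply: (@measurable_partial _ _ _ _ M_borel (c i) j
  (f \o chart_inv (c i))) => y.
exact: differentiable_on_chart.
Qed.

End Gradient.

(** * One-variable estimates *)

Section Truncation.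
Context (R : realType).
Implicit Types s t u x y q : R.

(** A smooth substitute for the identity whose derivative vanishes at [0]. The
    parameter [s] fixes the scale: [soft_cut s t] is comparable with [t] when
    [t ^+ 2] is at least [s]. *)
Definition soft_cut s t : R := t ^+ 3 / (t ^+ 2 + s).

Definition dsoft_cut s t : R :=
  (t ^+ 4 + 3 * s * t ^+ 2) / (t ^+ 2 + s) ^+ 2.

Lemma is_derive_soft_cut s t : 0 < s ->
  is_derive t 1 (soft_cut s) (dsoft_cut s t).
Proof.
move=> s0; have ts0 : t ^+ 2 + s != 0 by rewrite gt_eqF// ltr_wpDl// sqr_ge0.
have d1 : is_derive t 1 (fun x : R => x ^+ 2) (2 * t).
  by apply: is_derive_eq; rewrite /= -[t%:A]/(t * 1); ring.
have d2 : is_derive t 1 (fun x => x ^+ 2 + s) (2 * t).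
  by apply: is_derive_eq; rewrite addr0.
have dV := @is_deriveV R (fun x => x ^+ 2 + s) t _ _ ts0 d2.
have -> : soft_cut s = id * (fun x => x ^+ 2) * (fun x => (x ^+ 2 + s)^-1).
  by apply/funext => x; rewrite /soft_cut exprS.
apply: (is_derive_eq (is_deriveM (is_deriveM (is_derive_id t 1) d1) dV)).
transitivity (t * t ^+ 2 * (- (t ^+ 2 + s) ^- 2 * (2 * t)) +
  (t ^+ 2 + s)^-1 * (t * (2 * t) + t ^+ 2 * 1)) => //.
by rewrite /dsoft_cut; field.
Qed.

Lemma soft_cut_sqr_le s t : 0 < s -> soft_cut s t ^+ 2 <= t ^+ 2.
Proof.
move=> s0; have t0 : 0 <= t ^+ 2 by exact: sqr_ge0.
have d0 : 0 < t ^+ 2 + s by lra.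
have -> : soft_cut s t = t * (t ^+ 2 / (t ^+ 2 + s)).
  by rewrite /soft_cut mulrA -exprS.
rewrite exprMn ler_piMr//.
have z0 : 0 <= t ^+ 2 / (t ^+ 2 + s) by rewrite divr_ge0// ltW.
have z1 : t ^+ 2 / (t ^+ 2 + s) <= 1 by rewrite ler_pdivrMr// mul1r; lra.
by rewrite exprn_ile1.
Qed.

Lemma le_soft_cut_sqr s t : 0 < s -> s <= t ^+ 2 ->
  t ^+ 2 <= 4 * soft_cut s t ^+ 2.
Proof.
move=> s0 st; have d0 : 0 < t ^+ 2 + s by lra.
have -> : soft_cut s t = t * (t ^+ 2 / (t ^+ 2 + s)).
  by rewrite /soft_cut mulrA -exprS.
rewrite exprMn mulrCA ler_peMr ?sqr_ge0//.
have z1 : 2^-1 <= t ^+ 2 / (t ^+ 2 + s) by rewrite ler_pdivlMr//; lra.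
set z := _ / _ in z1 *; nra.
Qed.

Lemma dsoft_cut0 s : dsoft_cut s 0 = 0.
Proof. by rewrite /dsoft_cut !expr0n/= mulr0 addr0 mul0r. Qed.

Lemma dsoft_cut_sqr_le s t : 0 < s -> dsoft_cut s t ^+ 2 <= 4.
Proof.
move=> s0; have t0 : 0 <= t ^+ 2 by exact: sqr_ge0.
have d0 : 0 < (t ^+ 2 + s) ^+ 2 by rewrite exprn_gt0//; lra.
have t4 : t ^+ 4 = t ^+ 2 * t ^+ 2 by rewrite -exprD.
have z0 : 0 <= dsoft_cut s t.
  by rewrite /dsoft_cut divr_ge0 ?(ltW d0)// t4; nra.
have z2 : dsoft_cut s t <= 2.
  rewrite /dsoft_cut ler_pdivrMr// t4.
  by set w := t ^+ 2 in t0 *; nra.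
nra.
Qed.

(** The square root of the Gibbs weight, as a function of the potential. *)
Definition gibbs_root u : R := expR (- u / 2).

Lemma gibbs_root_sqr u : gibbs_root u ^+ 2 = expR (- u).
Proof. by rewrite /gibbs_root -expRM_natl; congr expR; field. Qed.

Lemma is_derive_gibbs_root u :
  is_derive u 1 gibbs_root (- gibbs_root u / 2).
Proof.
have d1 : is_derive u 1 (fun x => - x / 2) (- 2^-1).
  by apply: is_derive_eq; rewrite !scaler0 add0r -[LHS]/(2^-1 * -1) mulrN1.
have := @is_derive1_comp R expR _ u _ _ (is_derive_expR (- u / 2)) d1.
by rewrite mulrN -mulNr.
Qed.

(** The two branches of [Hq] cross at [1], and the exponent [2] dominates the
    exponent [q] below this point and is dominated above it. *)
Lemma Hq_max q x : 2 < q -> Hq q x = Num.max (x ^+ 2) (`|x| `^ q).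
Proof.
move=> q2; rewrite /Hq -real_normK ?num_real// -powR_mulrn//.
case: ifPn => x1.
  have [->|x0] := eqVneq `|x| 0.
    by rewrite !powR0 ?maxxx ?pnatr_eq0// gt_eqF//; lra.
  rewrite max_l// ger_powR// ?normr_gt0 ?x1 ?andbT; last by lra.
  by rewrite -normr_gt0 lt_neqAle eq_sym x0/=.
rewrite -ltNge in x1.
by rewrite max_r// ler_powR//; lra.
Qed.

(** For [y = 0] the left-hand side vanishes whatever [g] is; this is what the
    soft cut is designed for. *)
Lemma dsoft_cut_grad_le q s g y : 2 < q -> 0 < s ->
  dsoft_cut s y ^+ 2 * g ^+ 2 <= 4 * (Hq q (g / y) * y ^+ 2).
Proof.
move=> q2 s0; have [->|y0] := eqVneq y 0.
  by rewrite dsoft_cut0 expr0n/= mul0r mulr0 mulr0.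
have -> : g ^+ 2 = (g / y) ^+ 2 * y ^+ 2 by rewrite -exprMn divfK.
have hH : (g / y) ^+ 2 <= Hq q (g / y) by rewrite Hq_max// le_max lexx.
apply: ler_pM; [exact: sqr_ge0| |exact: dsoft_cut_sqr_le|].
  by rewrite mulr_ge0 ?sqr_ge0.
by rewrite ler_wpM2r ?sqr_ge0.
Qed.

Lemma ln_le_id x : 0 < x -> ln x <= x.
Proof.
move=> x0; have h : ln (1 + (x - 1)) <= x - 1 by apply: le_ln1Dx; lra.
by rewrite addrCA subrr addr0 in h; lra.
Qed.

(** Where [y ^+ 2 < s] the left-hand side is nonpositive. Elsewhere
    [y ^+ 2 <= 4 * soft_cut s y ^+ 2], and
    [ln (soft_cut s y ^+ 2) = u + 2 ln |h|]. With
    [w = |h|^eps * s / B^(p / 2)], the inequality [ln w <= w] bounds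
    [2 ln |h| - ln s] by [2 / eps * w + p / eps * ln (B / s)]: the normalization
    of [w] makes the powers of [s] combine into the homogeneous quotient
    [B / s]. *)
Lemma entropy_pointwise (eps B s y u : R) : 0 < eps -> 0 < B -> 0 < s ->
    0 <= u ->
  let p := 2 + eps in let h := soft_cut s y * gibbs_root u in
  y ^+ 2 * ln (y ^+ 2 / s) <=
  y ^+ 2 * (3 + u + p / eps * (B / s)) +
  8 / eps * (s / B `^ (p / 2)) * (soft_cut s y ^+ 2 * `|h| `^ eps).
Proof.
move=> eps0 B0 s0 u0; cbv zeta; set p := 2 + eps.
set h := _ * gibbs_root u; have p0 : 0 < p by rewrite /p; lra.
have Bp0 : 0 < B `^ (p / 2) by exact: powR_gt0.
have y0 : 0 <= y ^+ 2 by exact: sqr_ge0.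
have K0 : 0 <= 3 + u + p / eps * (B / s).
  by rewrite !addr_ge0// mulr_ge0// divr_ge0// ltW.
have RHS0 : 0 <= y ^+ 2 * (3 + u + p / eps * (B / s)) +
  8 / eps * (s / B `^ (p / 2)) * (soft_cut s y ^+ 2 * `|h| `^ eps).
  rewrite addr_ge0 ?(mulr_ge0 y0 K0)//.
  by rewrite mulr_ge0// mulr_ge0 ?divr_ge0 ?sqr_ge0 ?powR_ge0// ltW.
have [ys|sy] := ltrP (y ^+ 2) s.
  apply: le_trans RHS0; rewrite mulr_ge0_le0// ln_le0// ler_pdivrMr// mul1r.
  exact: ltW.
have y1 : 0 < y ^+ 2 by lra.
have yT := le_soft_cut_sqr s0 sy; set T := soft_cut s y ^+ 2 in yT *.
have T0 : 0 < T by lra.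
have hT : `|h| ^+ 2 = T * expR (- u).
  by rewrite real_normK ?num_real// /h exprMn gibbs_root_sqr.
have h0 : 0 < `|h|.
  rewrite normr_gt0; apply/eqP => hz; move: hT.
  rewrite hz normr0 expr0n/= => /esym/eqP.
  by rewrite mulf_eq0 !gt_eqF// expR_gt0.
have lnh : 2 * ln `|h| = ln T - u.
  have : ln (`|h| ^+ 2) = ln (T * expR (- u)) by rewrite hT.
  by rewrite lnXn// lnM ?posrE ?expR_gt0// expRK mulr_natl => ->.
pose w := `|h| `^ eps * (s / B `^ (p / 2)).
have w0 : 0 < w by rewrite mulr_gt0 ?powR_gt0// divr_gt0.
have lnw : ln w = eps * ln `|h| + ln s - p / 2 * ln B.
  rewrite /w lnM ?posrE ?powR_gt0 ?divr_gt0// ln_powR ln_div ?posrE//.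
  by rewrite ln_powR addrA.
have lnBs : ln B - ln s <= B / s.
  by rewrite -ln_div ?posrE//; apply: ln_le_id; rewrite divr_gt0.
have ln4 : ln 4 <= 3 :> R.
  by rewrite (_ : 4 = 1 + 3); [apply: le_ln1Dx; lra|ring].
have lny : ln (y ^+ 2 / s) <= ln 4 + ln T - ln s.
  rewrite ln_div ?posrE// lerD2r -lnM ?posrE//.
  by rewrite ler_ln ?posrE// mulr_gt0.
(* The constant 3 bounds [ln 4]; the identity [E1] uses [p = 2 + eps]. *)
have key : ln (y ^+ 2 / s) <= 3 + u + p / eps * (B / s) + 2 / eps * w.
  have lw := ln_le_id w0; rewrite lnw in lw.
  have e2 : 0 <= 2 / eps by rewrite divr_ge0// ltW.
  have pe : 0 <= p / eps by rewrite divr_ge0// ltW.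
  have h1 := ler_wpM2l e2 lw; have h2 := ler_wpM2l pe lnBs.
  have E1 : 2 / eps * (eps * ln `|h| + ln s - p / 2 * ln B) =
    2 * ln `|h| - ln s - p / eps * (ln B - ln s).
    by rewrite /p; field; rewrite gt_eqF.
  rewrite E1 lnh in h1; lra.
apply: (le_trans (ler_wpM2l y0 key)); rewrite mulrDr lerD2l.
rewrite [leRHS](_ : _ = 4 * T * (2 / eps * w)).
  by rewrite ler_wpM2r// mulr_ge0 ?divr_ge0// ltW.
by rewrite /w; field; rewrite !gt_eqF.
Qed.

End Truncation.

(** * Gibbs measures *)

(** The integral of [f] is at most that of its positive part, which lies below
    [g]. *)
Lemma integral_le_ge0 d (T : measurableType d) (R : realType)
    (mu : {measure set T -> \bar R}) (f g : T -> R) :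
    measurable_fun setT f -> measurable_fun setT g ->
    (forall x, 0 <= g x) -> (forall x, f x <= g x) ->
  (\int[mu]_x (f x)%:E <= \int[mu]_x (g x)%:E)%E.
Proof.
move=> mf mg g0 fg; rewrite integralE.
apply: (@le_trans _ _ (\int[mu]_x ((EFin \o f)^\+ x))%E).
  rewrite -[leRHS]sube0; apply: leeB => //.
  by apply: integral_ge0 => x _; exact: funeneg_ge0.
apply: ge0_le_integral => //.
- by apply: measurable_funepos; exact/measurable_EFinP.
- exact/measurable_EFinP.
- by move=> x _; rewrite funeposE/= -EFin_max lee_fin ge_max fg g0.
Qed.

Section GibbsMeasure.
Context (R : realType) (d : measure_display) (M : metricMeasurableType R d)
  (lambda mu : {measure set M -> \bar R}) (U : M -> R).
Hypothesis mU : measurable_fun setT U.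
Hypothesis Z_finite : (partition_fun lambda U < +oo)%E.
Hypothesis mu_gibbs : gibbs_measure lambda U mu.

Let Z := fine (partition_fun lambda U).

Lemma measurable_gibbs_weight : measurable_fun setT (fun x => expR (- U x)).
Proof. by apply: measurableT_comp => //; exact: measurableT_comp. Qed.

Lemma partition_fun_fine : partition_fun lambda U = Z%:E.
Proof.
by rewrite fineK// ge0_fin_numE// integral_ge0// => x _; rewrite lee_fin expR_ge0.
Qed.

Lemma partition_fun_ge0 : 0 <= Z.
Proof.
by rewrite fine_ge0// integral_ge0// => x _; rewrite lee_fin expR_ge0.
Qed.

(** If the partition function vanished then [mu] would be the zero measure, for
    which every function is almost everywhere [0]. *)
Lemma partition_fun_gt0 (f : M -> R) :
  ~ {ae mu, forall x, f x = 0} -> 0 < Z.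
Proof.
move=> nf; rewrite lt_neqAle partition_fun_ge0 andbT eq_sym.
apply/eqP => Z0; apply: nf; exists setT; split => //.
rewrite mu_gibbs// -/(partition_fun lambda U) partition_fun_fine Z0.
by rewrite mul0e.
Qed.

Lemma integral_gibbs (f : M -> R) : 0 < Z ->
    measurable_fun setT f -> (forall x, 0 <= f x) ->
  (\int[lambda]_x (f x * expR (- U x))%:E = Z%:E * \int[mu]_x (f x)%:E)%E.
Proof.
move=> Z0 mf f0.
rewrite -(@integral_density _ _ _ lambda mu (fun x => expR (- U x) / Z)).
- rewrite -ge0_integralZl//; last 3 first.
  + apply/measurable_EFinP; apply: measurable_funM => //.
    by apply: measurable_funM => //; exact: measurable_gibbs_weight.
  + by move=> x _; rewrite lee_fin mulr_ge0// divr_ge0 ?expR_ge0// ltW.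
  + by rewrite lee_fin ltW.
  apply: eq_integral => x _; rewrite -!EFinM; congr EFin; field.
  by rewrite gt_eqF.
- by move=> x; rewrite divr_ge0 ?expR_ge0// ltW.
- by apply: measurable_funM => //; exact: measurable_gibbs_weight.
- move=> A mA; rewrite mu_gibbs// partition_fun_fine inver gt_eqF//.
  under [RHS]eq_integral do rewrite EFinM.
  rewrite ge0_integralZr//.
  + by apply/measurable_EFinP/measurable_funTS; exact: measurable_gibbs_weight.
  + by rewrite lee_fin invr_ge0 ltW.
- by move=> x; rewrite lee_fin.
- exact/measurable_EFinP.
Qed.

End GibbsMeasure.

(** The inverse is written as [x * (x ^+ 2) `^ (-1)], which is also correct for
    [x = 0] and is a product of measurable functions. *)
Lemma measurable_inverse d (T : measurableType d) (R : realType) (f : T -> R) :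
  measurable_fun setT f -> measurable_fun setT (fun x => (f x)^-1).
Proof.
move=> mf; rewrite (_ : (fun _ => _) = fun x => f x * (f x ^+ 2) `^ (-1)).
  apply: measurable_funM => //; apply: (measurableT_comp (measurable_powR _)).
  exact: measurable_funX.
apply/funext => x; rewrite powR_inv1 ?sqr_ge0//.
have [->|f0] := eqVneq (f x) 0; first by rewrite invr0 mul0r.
by rewrite expr2 invfM mulrA divff ?mul1r.
Qed.

(** * The ground state transform *)

Section GroundState.
Context (R : realType) (n m : nat) (d : measure_display)
  (M : metricMeasurableType R d) (c : nat -> chart R n M)
  (nabla : (M -> R) -> M -> 'rV[R]_m).
Hypothesis M_borel : borel_measurable M.
Hypothesis c_atlas : smooth_atlas c.
Hypothesis nabla_gradient : sub_gradient c nabla.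
Variables (q s : R) (f U : M -> R).
Hypothesis q_gt2 : 2 < q.
Hypothesis s_gt0 : 0 < s.
Hypothesis df : differentiable_fun c f.
Hypothesis dU : differentiable_fun c U.

(** Multiplication by [f x ^+ 2] already makes this vanish where [f x = 0],
    which removes the case distinction in [modified_energy]. *)
Definition energy_density (x : M) : R :=
  Hq q (gradnorm nabla f x / f x) * f x ^+ 2.

(** The function to which the Sobolev inequality is applied: the ground state
    transform [f exp (- U / 2)], with [f] replaced by its soft cut. *)
Definition ground_state (x : M) : R := soft_cut s (f x) * gibbs_root (U x).

Lemma energy_density_ge0 x : 0 <= energy_density x.
Proof.
by rewrite mulr_ge0 ?sqr_ge0// Hq_max// le_max sqr_ge0.
Qed.

Lemma modified_energyE (mu : {measure set M -> \bar R}) :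
  modified_energy nabla mu q f = (\int[mu]_x (energy_density x)%:E)%E.
Proof.
apply: eq_integral => x _; congr EFin; rewrite /energy_density.
by case: eqP => // ->; rewrite expr0n mulr0.
Qed.

Lemma measurable_energy_density : measurable_fun setT energy_density.
Proof.
have mf := measurable_differentiable_fun c_atlas M_borel df.
have mg := measurable_gradnorm c_atlas nabla_gradient M_borel df.
have mr : measurable_fun setT (fun x => gradnorm nabla f x / f x).
  by apply: measurable_funM => //; exact: measurable_inverse.
apply: measurable_funM; last exact: measurable_funX.
under eq_fun do rewrite Hq_max//.
apply: measurable_maxr; first exact: measurable_funX.
apply: (measurableT_comp (measurable_powR q)).
exact: measurableT_comp.
Qed.

Lemma ground_state_sqr_le x : ground_state x ^+ 2 <= f x ^+ 2 * expR (- U x).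
Proof.
by rewrite exprMn gibbs_root_sqr ler_wpM2r ?expR_ge0// soft_cut_sqr_le.
Qed.

Lemma ground_state_differentiable : differentiable_fun c ground_state.
Proof.
by have [] := gradient_product c_atlas nabla_gradient df dU
  (fun z => is_derive_soft_cut z s_gt0) (@is_derive_gibbs_root R).
Qed.

Lemma ground_state_gradnorm x :
  gradnorm nabla ground_state x ^+ 2 <=
  (8 * energy_density x + 2^-1 * (f x ^+ 2 * gradnorm nabla U x ^+ 2))
  * expR (- U x).
Proof.
have [_ gE] := gradient_product c_atlas nabla_gradient df dU
  (fun z => is_derive_soft_cut z s_gt0) (@is_derive_gibbs_root R).
apply: (le_trans (gradnorm_sqr_comb (gE x))).
have := dsoft_cut_grad_le (gradnorm nabla f x) (f x) q_gt2 s_gt0.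
have := soft_cut_sqr_le (f x) s_gt0.
rewrite /energy_density; move: (soft_cut s _) (dsoft_cut s _) => t t' tf t'E.
rewrite !exprMn sqrrN gibbs_root_sqr.
have w0 := expR_ge0 (- U x); have u0 := sqr_ge0 (gradnorm nabla U x).
have := ler_wpM2r w0 t'E; have := ler_wpM2r w0 (ler_wpM2r u0 tf).
rewrite exprVn; lra.
Qed.

End GroundState.

(** * The entropy estimate *)

(** Undoes the outer exponent [2 / (2 + eps)] of the Sobolev inequality; the
    case [N = +oo] is excluded by the hypothesis. *)
Lemma poweR_le_inv (R : realType) (N : \bar R) (r B : R) : 0 < r -> 0 <= B ->
  (0 <= N)%E -> (N `^ r^-1 <= B%:E)%E -> (N <= (B `^ r)%:E)%E.
Proof.
move=> r0 B0 N0 NB; rewrite -[N]poweRe1// -(mulVf (lt0r_neq0 r0)) poweRrM.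
rewrite -poweR_EFin; apply: gt0_ler_poweR => //; first exact: ltW.
- by rewrite in_itv/= poweR_ge0 leey.
- by rewrite in_itv/= lee_fin B0 leey.
Qed.

Section EntropyEstimate.
Context (R : realType) (n m : nat) (d : measure_display)
  (M : metricMeasurableType R d) (c : nat -> chart R n M)
  (nabla : (M -> R) -> M -> 'rV[R]_m)
  (lambda mu : {measure set M -> \bar R}).
Hypothesis M_borel : borel_measurable M.
Hypothesis c_atlas : smooth_atlas c.
Hypothesis nabla_gradient : sub_gradient c nabla.
Variables (q s e J : R) (f U : M -> R).
Hypothesis q_gt2 : 2 < q.
Hypothesis s_gt0 : 0 < s.
Hypothesis e_ge0 : 0 <= e.
Hypothesis J_ge0 : 0 <= J.
Hypothesis df : differentiable_fun c f.
Hypothesis dU : differentiable_fun c U.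
Hypothesis U_ge0 : forall x, 0 <= U x.
Hypothesis Z_finite : (partition_fun lambda U < +oo)%E.
Hypothesis mu_gibbs : gibbs_measure lambda U mu.
Let Z := fine (partition_fun lambda U).
Hypothesis Z_gt0 : 0 < Z.
(** The mass of [f ^+ 2] is also the scale [s] of the cut. *)
Hypothesis massE : sq_mass mu f = s%:E.
Hypothesis energyE : modified_energy nabla mu q f = e%:E.
Hypothesis U_bound :
  (\int[mu]_x (`|f x| ^+ 2 * (gradnorm nabla U x ^+ 2 + U x))%:E <= J%:E)%E.

Let h := ground_state s f U.
Let mf : measurable_fun setT f :=
  measurable_differentiable_fun c_atlas M_borel df.
Let mU : measurable_fun setT U :=
  measurable_differentiable_fun c_atlas M_borel dU.
Let mgU : measurable_fun setT (gradnorm nabla U) :=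
  measurable_gradnorm c_atlas nabla_gradient M_borel dU.
Let dh : differentiable_fun c h :=
  ground_state_differentiable c_atlas nabla_gradient s_gt0 df dU.
Let mh : measurable_fun setT h :=
  measurable_differentiable_fun c_atlas M_borel dh.
Let mf2 : measurable_fun setT (fun x => f x ^+ 2) :=
  measurable_funX 2 mf.
Let mw : measurable_fun setT (fun x => expR (- U x)) :=
  measurable_gibbs_weight mU.

Lemma integral_sqr : (\int[mu]_x (f x ^+ 2)%:E = s%:E)%E.
Proof.
rewrite -massE; apply: eq_integral => x _.
by rewrite real_normK ?num_real.
Qed.

(** Used for [v = U] and for [v] the squared norm of the gradient of [U]: both
    are dominated by the potential of the assumed inequality. *)
Lemma integral_sqr_part (v : M -> R) : measurable_fun setT v ->
  (forall x, 0 <= v x <= gradnorm nabla U x ^+ 2 + U x) ->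
  (\int[mu]_x (f x ^+ 2 * v x)%:E <= J%:E)%E.
Proof.
move=> mv v0; apply: le_trans U_bound.
have f2 x : `|f x| ^+ 2 = f x ^+ 2 by rewrite real_normK ?num_real.
apply: integral_le_ge0.
- exact: measurable_funM.
- under eq_fun do rewrite f2; apply: measurable_funM => //.
  by apply: measurable_funD => //; exact: measurable_funX.
- by move=> x; rewrite mulr_ge0 ?addr_ge0 ?sqr_ge0.
- by move=> x; rewrite f2 ler_wpM2l ?sqr_ge0//; have /andP[] := v0 x.
Qed.

Lemma ground_state_mass :
  (\int[lambda]_x (`|h x| ^+ 2)%:E <= (Z * s)%:E)%E.
Proof.
rewrite EFinM -integral_sqr -(integral_gibbs mU Z_finite mu_gibbs)//.
  apply: integral_le_ge0.
  - by apply: measurable_funX; exact: measurableT_comp.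
  - exact: measurable_funM.
  - by move=> x; rewrite mulr_ge0 ?sqr_ge0 ?expR_ge0.
  - by move=> x; rewrite real_normK ?num_real// ground_state_sqr_le.
by move=> x; exact: sqr_ge0.
Qed.

Lemma ground_state_energy :
  (\int[lambda]_x (gradnorm nabla h x ^+ 2)%:E <= (Z * (8 * e + J / 2))%:E)%E.
Proof.
have mE := measurable_energy_density M_borel c_atlas nabla_gradient q_gt2 df.
have E0 x := energy_density_ge0 nabla f q_gt2 x.
have mV : measurable_fun setT (fun x => f x ^+ 2 * gradnorm nabla U x ^+ 2).
  by apply: measurable_funM => //; exact: measurable_funX.
pose G x := 8 * energy_density nabla q f x +
            2^-1 * (f x ^+ 2 * gradnorm nabla U x ^+ 2).
have mG : measurable_fun setT G.
  by apply: measurable_funD; apply: measurable_funM.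
have G0 x : 0 <= G x.
  by rewrite addr_ge0// mulr_ge0// mulr_ge0 ?sqr_ge0.
apply: (@le_trans _ _ (\int[lambda]_x (G x * expR (- U x))%:E)%E).
  apply: integral_le_ge0.
  - by apply: measurable_funX; exact: measurable_gradnorm dh.
  - exact: measurable_funM.
  - by move=> x; rewrite mulr_ge0 ?expR_ge0.
  - by move=> x; apply: (ground_state_gradnorm c_atlas).
rewrite (integral_gibbs mU Z_finite mu_gibbs)// EFinM.
apply: lee_wpmul2l; first by rewrite lee_fin ltW.
under eq_integral do rewrite /G EFinD (EFinM 8) (EFinM 2^-1).
rewrite ge0_integralD//; last 4 first.
- by move=> x _; rewrite -EFinM lee_fin mulr_ge0.
- by apply: measurable_funeM; exact/measurable_EFinP.
- by move=> x _; rewrite -EFinM lee_fin mulr_ge0// mulr_ge0 ?sqr_ge0.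
- by apply: measurable_funeM; exact/measurable_EFinP.
rewrite !ge0_integralZl_EFin//; last 4 first.
- by move=> x _; rewrite lee_fin mulr_ge0 ?sqr_ge0.
- exact/measurable_EFinP.
- by move=> x _; rewrite lee_fin.
- exact/measurable_EFinP.
rewrite -modified_energyE energyE (mulrC J).
rewrite (EFinD (8 * e)) (EFinM 8) (EFinM 2^-1).
apply: leeD2l; apply: lee_wpmul2l => //.
apply: integral_sqr_part; first exact: measurable_funX.
by move=> x; rewrite sqr_ge0 lerDl U_ge0.
Qed.

Variables (eps alpha beta : R).
Hypothesis eps_gt0 : 0 < eps.
Hypothesis alpha_gt0 : 0 < alpha.
Hypothesis beta_gt0 : 0 < beta.
Hypothesis sobolev : forall g : M -> R, differentiable_fun c g ->
  ((\int[lambda]_x (`|g x| `^ (2 + eps))%:E) `^ (2 / (2 + eps))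
   <= alpha%:E * (\int[lambda]_x (gradnorm nabla g x ^+ 2)%:E)
      + beta%:E * (\int[lambda]_x (`|g x| ^+ 2)%:E))%E.

Let p := 2 + eps.
(** The right-hand side of the Sobolev inequality for the ground state. *)
Let B := Z * (alpha * (8 * e + J / 2) + beta * s).

Lemma sobolev_bound_gt0 : 0 < B.
Proof.
apply: mulr_gt0 => //; apply: ltr_wpDl; last exact: mulr_gt0.
apply: mulr_ge0; first exact: ltW.
by rewrite addr_ge0 ?divr_ge0// mulr_ge0.
Qed.

Lemma ground_state_sobolev :
  (\int[lambda]_x (`|h x| `^ p)%:E <= (B `^ (p / 2))%:E)%E.
Proof.
have p0 : 0 < p by rewrite addr_gt0.
apply: poweR_le_inv; [by rewrite divr_gt0|exact: ltW sobolev_bound_gt0| |].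
  by apply: integral_ge0 => x _; rewrite lee_fin powR_ge0.
rewrite invf_div; apply: (le_trans (sobolev dh)).
rewrite (_ : B = alpha * (Z * (8 * e + J / 2)) + beta * (Z * s)); last first.
  by rewrite /B; ring.
rewrite EFinD !(EFinM alpha) !(EFinM beta).
apply: leeD; (apply: lee_wpmul2l; first by rewrite lee_fin ltW).
  exact: ground_state_energy.
exact: ground_state_mass.
Qed.

(** The weight [exp (- U)] turns [soft_cut s f ^+ 2 * |h|^eps] into
    [|h|^(2 + eps)], so this is the Sobolev bound read under [mu]. *)
Lemma ground_state_moment :
  (\int[mu]_x (soft_cut s (f x) ^+ 2 * `|h x| `^ eps)%:E <=
   (B `^ (p / 2) / Z)%:E)%E.
Proof.
have mt : measurable_fun setT (fun x => soft_cut s (f x)).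
  apply: measurable_funM; first exact: measurable_funX.
  by apply: measurable_inverse; exact: measurable_funD.
rewrite (mulrC _ Z^-1) (EFinM Z^-1) lee_pdivlMl//.
rewrite -(integral_gibbs mU Z_finite mu_gibbs)//; last 2 first.
- apply: measurable_funM; first exact: measurable_funX.
  by apply: (measurableT_comp (measurable_powR _)); exact: measurableT_comp.
- by move=> x; rewrite mulr_ge0 ?sqr_ge0 ?powR_ge0.
apply: le_trans ground_state_sobolev.
rewrite le_eqVlt; apply/orP; left; apply/eqP; apply: eq_integral => x _.
congr EFin; rewrite /p.
have [->|h0] := eqVneq (h x) 0.
  rewrite normr0 !powR0 ?mulr0 ?mul0r// gt_eqF//; rewrite ?addr_gt0//; lra.
rewrite powRD; last by rewrite normr_eq0 h0 implybT.
rewrite powR_mulrn// real_normK ?num_real//.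
have -> : h x ^+ 2 = soft_cut s (f x) ^+ 2 * expR (- U x).
  by rewrite /h /ground_state exprMn gibbs_root_sqr.
by rewrite mulrAC.
Qed.

(** Integral of [entropy_pointwise]. The coefficient [s / B^(p / 2)] cancels the
    Sobolev bound on the moment, so that the right-hand side is linear in [e],
    [s] and [J]. *)
Lemma entropy_bound :
  (\int[mu]_x (`|f x| ^+ 2 * ln (`|f x| ^+ 2 / s))%:E
   <= (3 * s + J + p / eps * B + 8 / eps * (s / Z))%:E)%E.
Proof.
have p0 : 0 < p by rewrite addr_gt0.
have B0 := sobolev_bound_gt0.
have Bp0 : 0 < B `^ (p / 2) by exact: powR_gt0.
have f2 x : `|f x| ^+ 2 = f x ^+ 2 by rewrite real_normK ?num_real.
pose K1 := 3 + p / eps * (B / s).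
pose K2 := 8 / eps * (s / B `^ (p / 2)).
have K10 : 0 <= K1 by rewrite addr_ge0// mulr_ge0// divr_ge0// ltW.
have K20 : 0 <= K2 by rewrite mulr_ge0// divr_ge0// ltW.
pose V x := soft_cut s (f x) ^+ 2 * `|h x| `^ eps.
have V0 x : 0 <= V x by rewrite mulr_ge0 ?sqr_ge0 ?powR_ge0.
have mV : measurable_fun setT V.
  apply: measurable_funM.
    apply: measurable_funX; apply: measurable_funM; first exact: measurable_funX.
    by apply: measurable_inverse; exact: measurable_funD.
  by apply: (measurableT_comp (measurable_powR _)); exact: measurableT_comp.
have f2_ge0 x : 0 <= f x ^+ 2 by exact: sqr_ge0.
have fU0 x : 0 <= f x ^+ 2 * U x by exact: mulr_ge0.
have K1f0 x : 0 <= K1 * f x ^+ 2 by exact: mulr_ge0.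
have K2V0 x : 0 <= K2 * V x by exact: mulr_ge0.
have mK1 : measurable_fun setT (fun x => K1 * f x ^+ 2) by exact: measurable_funM.
have mfU : measurable_fun setT (fun x => f x ^+ 2 * U x).
  exact: measurable_funM.
have mK2 : measurable_fun setT (fun x => K2 * V x) by exact: measurable_funM.
apply: (@le_trans _ _
  (\int[mu]_x (K1 * f x ^+ 2 + (f x ^+ 2 * U x + K2 * V x))%:E)%E).
  apply: integral_le_ge0.
  - under eq_fun do rewrite f2; apply: measurable_funM => //.
    by apply: measurableT_comp => //; exact: measurable_funM.
  - by apply: measurable_funD => //; exact: measurable_funD.
  - by move=> x; apply: addr_ge0 => //; exact: addr_ge0.
  - move=> x; rewrite f2.
    apply: (le_trans (@entropy_pointwise R eps B s (f x) (U x) _ _ _ _)) => //.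
    rewrite le_eqVlt; apply/orP; left; apply/eqP.
    by rewrite /K1 /K2 /V /h /ground_state -/p; ring.
under eq_integral do rewrite 2!EFinD !(EFinM K1) !(EFinM K2).
rewrite ge0_integralD//; last 4 first.
- by move=> x _; rewrite -EFinM lee_fin.
- by apply: measurable_funeM; exact/measurable_EFinP.
- by move=> x _; rewrite -EFinM -EFinD lee_fin; exact: addr_ge0.
- apply: emeasurable_funD; first exact/measurable_EFinP.
  by apply: measurable_funeM; exact/measurable_EFinP.
rewrite ge0_integralD//; last 4 first.
- by move=> x _; rewrite lee_fin.
- exact/measurable_EFinP.
- by move=> x _; rewrite -EFinM lee_fin.
- by apply: measurable_funeM; exact/measurable_EFinP.
rewrite !ge0_integralZl_EFin//; last 4 first.
- by move=> x _; rewrite lee_fin.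
- exact/measurable_EFinP.
- by move=> x _; rewrite lee_fin.
- exact/measurable_EFinP.
rewrite integral_sqr.
apply: (@le_trans _ _ (K1%:E * s%:E + (J%:E + K2%:E * (B `^ (p / 2) / Z)%:E))%E).
  apply: leeD2l; apply: leeD.
    by apply: integral_sqr_part => // x; rewrite U_ge0 lerDr sqr_ge0.
  by apply: lee_wpmul2l; [rewrite lee_fin|exact: ground_state_moment].
rewrite -!EFinM -!EFinD lee_fin le_eqVlt; apply/orP; left; apply/eqP.
by rewrite /K1 /K2; field; rewrite !gt_eqF.
Qed.

End EntropyEstimate.

Theorem proposition2p6 (R : realType) (n m : nat) (disp : measure_display)
    (M : metricMeasurableType R disp) (c : nat -> chart R n M)
    (lambda : {measure set M -> \bar R})
    (nabla : (M -> R) -> M -> 'rV[R]_m) (x0 : M)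
    (M_noncompact : ~ compact [set: M])
    (M_borel : borel_measurable M)
    (c_atlas : smooth_atlas c)
    (lambda_lebesgue : lebesgue_in_charts c lambda)
    (nabla_gradient : sub_gradient c nabla)
    (assumption1 : distance_assumption c lambda nabla x0)
    (assumption2 : classical_sobolev c lambda nabla)
    (assumption3 : local_poincare c lambda nabla)
    (q : R) (q_gt2 : 2 < q)
    (U : M -> R) (U_ge0 : forall x, 0 <= U x)
    (U_differentiable : differentiable_fun c U)
    (Z_finite : (partition_fun lambda U < +oo)%E)
    (mu : {measure set M -> \bar R}) (mu_gibbs : gibbs_measure lambda U mu)
    (U_bound : exists Chat Dhat : R, [/\ 0 < Chat, 0 < Dhat &
       forall f : M -> R, test_fun c mu f ->
         (\int[mu]_x (`|f x| ^+ 2 * (gradnorm nabla U x ^+ 2 + U x))%:E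
          <= Chat%:E * modified_energy nabla mu q f
             + Dhat%:E * sq_mass mu f)%E]) :
  exists C D : R, [/\ 0 < C, 0 < D &
    forall f : M -> R, test_fun c mu f ->
      (\int[mu]_x (`|f x| ^+ 2 * ln (`|f x| ^+ 2 / fine (sq_mass mu f)))%:E
       <= C%:E * modified_energy nabla mu q f + D%:E * sq_mass mu f)%E].
Proof.
have [eps [alpha [beta [eps0 alpha0 beta0 sobolev]]]] := assumption2.
have [Chat [Dhat [Chat0 Dhat0 Ubound]]] := U_bound.
have Z0 := partition_fun_ge0 lambda U.
set Z := fine (partition_fun lambda U) in Z0.
pose p := 2 + eps.
have p0 : 0 < p by rewrite addr_gt0.
have r0 : 0 <= p / eps by rewrite divr_ge0// ltW.
exists (Chat + p / eps * (Z * (alpha * (8 + Chat / 2)))).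
exists (3 + Dhat + p / eps * (Z * (alpha * (Dhat / 2) + beta)) +
        8 / eps * Z^-1).
split.
- apply: ltr_pwDl => //; rewrite mulr_ge0// mulr_ge0// mulr_ge0 ?ltW//.
  by rewrite addr_gt0// divr_gt0.
- rewrite ltr_pwDl//; last by rewrite mulr_ge0 ?invr_ge0// divr_ge0// ltW.
  rewrite ltr_pwDl ?addr_gt0// mulr_ge0// mulr_ge0// ltW// addr_gt0// mulr_gt0//.
  exact: divr_gt0.
move=> f tf; have [sf nf mass_fin] := tf.
have df := smooth_differentiable sf.
have mU := measurable_differentiable_fun c_atlas M_borel U_differentiable.
have mf := measurable_differentiable_fun c_atlas M_borel df.
have Zgt0 : 0 < Z by exact: partition_fun_gt0 nf.
have mass0 : (0 <= sq_mass mu f)%E.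
  by apply: integral_ge0 => x _; rewrite lee_fin sqr_ge0.
set s := fine (sq_mass mu f).
have massE : sq_mass mu f = s%:E by rewrite fineK// ge0_fin_numE.
(* A test function has positive mass: otherwise it would vanish [mu]-a.e. *)
have s0 : 0 < s.
  rewrite -lte_fin -massE lt_neqAle mass0 andbT; apply/eqP => m0; apply: nf.
  have mf2 : measurable_fun setT (fun x => (`|f x| ^+ 2)%:E).
    apply/measurable_EFinP; apply: measurable_funX; exact: measurableT_comp.
  have : (\int[mu]_x `|(`|f x| ^+ 2)%:E| = 0)%E.
    transitivity (sq_mass mu f) => //; apply: eq_integral => x _.
    by rewrite gee0_abs// lee_fin sqr_ge0.
  move/(ae_eq_integral_abs _ measurableT mf2).
  apply: filterS => x /(_ I) /= [] /eqP.
  by rewrite expf_eq0/= normr_eq0 => /eqP.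
have energy0 : (0 <= modified_energy nabla mu q f)%E.
  rewrite modified_energyE; apply: integral_ge0 => x _.
  by rewrite lee_fin energy_density_ge0.
have C0 : 0 < Chat + p / eps * (Z * (alpha * (8 + Chat / 2))).
  apply: ltr_pwDl => //; rewrite mulr_ge0// mulr_ge0// mulr_ge0 ?ltW//.
  by rewrite addr_gt0// divr_gt0.
(* If the modified energy is infinite there is nothing to prove. *)
rewrite massE; have [fin|] := boolP (modified_energy nabla mu q f \is a fin_num);
  last first.
  rewrite ge0_fin_numE// -leNgt leye_eq => /eqP ->.
  by rewrite gt0_muley ?lte_fin// addye ?leey// -EFinM.
set e := fine (modified_energy nabla mu q f).
have energyE : modified_energy nabla mu q f = e%:E by rewrite fineK.
have e0 : 0 <= e by rewrite -lee_fin -energyE.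
have J0 : 0 <= Chat * e + Dhat * s.
  by rewrite addr_ge0 ?mulr_ge0 ?(ltW s0) ?(ltW Chat0) ?(ltW Dhat0).
have UJ := Ubound f tf; rewrite massE energyE -!EFinM -EFinD in UJ.
apply: (le_trans (entropy_bound M_borel c_atlas nabla_gradient q_gt2 s0 e0 J0
  df U_differentiable U_ge0 Z_finite mu_gibbs Zgt0 massE energyE UJ
  eps0 alpha0 beta0 sobolev)).
rewrite energyE -!EFinM -EFinD lee_fin le_eqVlt; apply/orP; left; apply/eqP.
by rewrite -/Z -/p; field; rewrite !gt_eqF.
Qed.
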